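(* For all positive integers $r$ and $s$, and all non-negative integers $n=n_0+3n_1+9n_2+\dots+3^mn_m$, where $0\le n_i\le 2$ for all $i$, we have $$a_n(r,s)\equiv \prod_{i=0}^{m}a_{n_i}(r,s)+3\sum_{\nu=1}^m\Bigg(\prod_{\substack{0\le i\le m\\ i\ne \nu-1,\nu}} a_{n_i}(r,s)\Bigg) f(n_{\nu-1},n_{\nu};r,s)\pmod 9,$$ where $$\begin{aligned} f(n_{\nu-1},n_{\nu};r,s)={}& n_{\nu-1}(n_{\nu-1}+1)n_{\nu}\Big(s(n_{\nu}+1)+(-1)^s\big(s(n_{\nu}-1)+rn_{\nu}\big)\Big)\\ &+\chi(r=1)\,(n_{\nu-1}+2)(n_{\nu-1}+1)n_{\nu}\\ &+\chi(s=1)\,\big((-1)^r-1\big)(n_{\nu-1}-1)n_{\nu-1}n_{\nu}^2 .\end{aligned}$$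
   Context: For non-negative integers $r,s,n$, the (generalised) Apéry numbers are $a_n(r,s)=\sum_{k=0}^n\binom nk^r\binom{n+k}k^s$. Here $\chi(\mathcal S)=1$ if the statement $\mathcal S$ is true and $\chi(\mathcal S)=0$ otherwise. Empty products equal $1$ and empty sums equal $0$. *)

(* Defs.v *)
From mathcomp Require Import all_boot all_order all_algebra.

Set Implicit Arguments.
Unset Strict Implicit.
Unset Printing Implicit Defensive.

Import GRing.Theory.

Local Open Scope ring_scope.

Definition apery (r s n : nat) : nat :=
  (\sum_(0 <= k < n.+1) 'C(n, k) ^ r * 'C(n + k, k) ^ s)%N.

Definition chi (b : bool) : int := (nat_of_bool b)%:Z.

(* [x] and [y] stand for consecutive ternary digits n_(nu-1) and n_nu.  They
   are integers because [x - 1] and [y - 1] are genuine, not truncated,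
   subtractions. *)
Definition apery_f (x y : int) (r s : nat) : int :=
    x * (x + 1) * y
      * (s%:Z * (y + 1) + (-1) ^+ s * (s%:Z * (y - 1) + r%:Z * y))
  + chi (r == 1%N) * (x + 2) * (x + 1) * y
  + chi (s == 1%N) * ((-1) ^+ r - 1) * (x - 1) * x * y ^+ 2.

(* Main.v *)
(* Modulo 9, binomial coefficients satisfy a two-digit Lucas rule: for i < 3 and
   j < i + 3, C(3N + j, 3K + i) = C(N, K) * bfac j i N K, where bfac depends only
   on i, j and on N, K mod 3, and bfac j i N K = C(j, i) mod 3.  Hence the k-th
   term of a_(3N+x) is, up to such a factor, the (k div 3)-th term of a_N.
   Summing by blocks of three, and then once more by blocks of three, gives
     a_(9N+3y+x) - a_x a_(3N+y) = a_N (a_(3y+x) - a_x a_y)  mod 9,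
   so everything reduces to a_(3y+x) = a_x a_y + 3 f(x, y) for digits x, y.
   Modulo 9 both sides have period 6 in r for r > 1 and in s for s > 1, so it is a
   finite computation. *)
Require Import Defs.
From mathcomp Require Import all_boot all_order all_algebra.
From mathcomp Require Import ring zify.

Import GRing.Theory.

Local Open Scope ring_scope.

(** * Arithmetic in Z/9 *)

Lemma Z9_mul33 : 3 * 3 = 0 :> 'Z_9.
Proof. exact: val_inj. Qed.

Lemma Z9_3Ml (x y : 'Z_9) : 3 * (3 * x + y) = 3 * y.
Proof. by rewrite mulrDr mulrA Z9_mul33 mul0r add0r. Qed.

Lemma intr9_mod (x y : int) : x%:~R = y%:~R :> 'Z_9 -> (x = y %[mod 9])%Z.
Proof.
move=> exy; apply/eqP; rewrite eqz_mod_dvd.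
have : (x - y)%:~R = 0 :> 'Z_9 by rewrite rmorphB /= exy subrr.
have nat9 (n : nat) : n%:R = 0 :> 'Z_9 -> (9 %| n)%N.
  by move=> e; apply/eqP; have := congr1 val e; rewrite /= Zp_nat.
case: (x - y) => n; first by move/nat9.
by rewrite NegzE rmorphN /= => /eqP; rewrite oppr_eq0 => /eqP /nat9.
Qed.

(** [ring] does not know that 9 vanishes; [z] supplies the multiple of 9 by which the two sides
    differ formally. *)
Lemma Z9_eqDM9 (z x y : 'Z_9) : x = y + 3 * 3 * z -> x = y.
Proof. by rewrite Z9_mul33 mul0r addr0. Qed.

(** * Binomial coefficients modulo 9 *)

(** These are the coefficients of (1+X^3)^N + 3N(X+X^2)(1+X^3)^(N-1); each step of the induction on
    N applies Pascal's rule three times. *)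
Lemma bin_mul3_mod9 (N K : nat) :
  [/\ 'C(3 * N, 3 * K)%:R = 'C(N, K)%:R :> 'Z_9,
      'C(3 * N, (3 * K).+1)%:R = 3 * (N * 'C(N.-1, K))%:R :> 'Z_9
    & 'C(3 * N, (3 * K).+2)%:R = 3 * (N * 'C(N.-1, K))%:R :> 'Z_9].
Proof.
elim: N K => [|N IH] K.
  by rewrite !muln0 !mul0n; case: K => [|K]; rewrite ?muln0 ?bin0n // mulr0.
have NC k : N%:R * 'C(N.-1, k.+1)%:R + N%:R * 'C(N.-1, k)%:R
            = N%:R * 'C(N, k.+1)%:R :> 'Z_9.
  by case: N {IH} => [|N]; rewrite ?mul0r ?addr0 //= binS natrD mulrDr.
rewrite (mulnS 3 N) !addSn add0n /=.
case: K => [|K].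
  have [_ e1 e2] := IH 0%N; move: e1 e2; rewrite !muln0 => e1 e2.
  rewrite !binS !bin0 !natrD !natrM e1 e2 !natrM !bin0.
  split; first by [].
    by ring.
  by apply: (@Z9_eqDM9 N%:R); ring.
have [e0 e1 e2] := IH K; have [f0 f1 f2] := IH K.+1.
move: f0 f1 f2; rewrite (mulnS 3 K) !addSn add0n => f0 f1 f2.
rewrite !binS !natrD e0 e1 e2 f0 f1 f2 !natrM.
rewrite -NC; split.
- by apply: (@Z9_eqDM9 (2 * (N%:R * 'C(N.-1, K)%:R))); ring.
- by apply: (@Z9_eqDM9 (N%:R * 'C(N.-1, K)%:R)); ring.
by apply: (@Z9_eqDM9 (N%:R * 'C(N.-1, K.+1)%:R)); ring.
Qed.

(* In (1+X)^(3N+j) = ((1+X^3)^N + 3N(X+X^2)(1+X^3)^(N-1)) (1+X)^j mod 9, the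
   coefficient of X^(3K+i) for j < i + 3 is C(N, K) times
     C(j,i) + 3((N-K)(C(j,i-1) + C(j,i-2)) + K(C(j,i+1) + C(j,i+2)));
   C(j+2,i) - C(j+1,i) = C(j,i-1) + C(j,i-2) avoids negative lower indices. *)
Definition bfac (j i N K : nat) : 'Z_9 :=
  'C(j, i)%:R + 3 * ((N%:R - K%:R) * ('C(j.+2, i)%:R - 'C(j.+1, i)%:R)
                     + K%:R * 'C(j.+1, i.+2)%:R).

(** Pascal's rule reduces [j] to 0. For j >= i + 3 the coefficient would also involve C(N, K-1); the
    bounds leave twelve pairs (i, j). *)
Lemma bin_digit_mod9 (N K i j : nat) : (i < 3)%N -> (j < i + 3)%N ->
  'C(3 * N + j, 3 * K + i)%:R = 'C(N, K)%:R * bfac j i N K.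
Proof.
move=> lt_i3 lt_ji3.
have [e0 e1 e2] := bin_mul3_mod9 N K; rewrite mul_bin_down natrM in e1 e2.
(* Truncated subtraction is harmless, since C(N, K) = 0 when N < K. *)
have NK : (N - K)%:R * 'C(N, K)%:R = (N%:R - K%:R) * 'C(N, K)%:R :> 'Z_9.
  have [leKN | ltNK] := leqP K N; first by rewrite natrB.
  by rewrite bin_small // !mulr0.
rewrite NK in e1 e2; rewrite /bfac.
have cases (P : nat -> nat -> Prop) :
    P 0 0 -> P 0 1 -> P 0 2 -> P 1 0 -> P 1 1 -> P 1 2 -> P 1 3 ->
    P 2 0 -> P 2 1 -> P 2 2 -> P 2 3 -> P 2 4 -> P i j.
  by do 3?[case: i lt_i3 lt_ji3 => [|i] // lt_i3 lt_ji3];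
    do 5?[case: j lt_ji3 => [|j] // lt_ji3].
case: K e0 e1 e2 {NK} => [|K] e0 e1 e2.
  rewrite !muln0 bin0 in e0 e1 e2 *.
  pattern i, j; apply: cases;
    rewrite ?(addnS, addn0, add0n) !binS ?(bin0, binS, bin0n) ?natrD;
    rewrite ?e1 ?e2 ?bin0 /=;
    first [ by ring | by apply: (@Z9_eqDM9 (- N%:R)); ring ].
(* Pascal's rule also reaches lower indices just below 3(K+1); N C(N-1, K) = (K+1) C(N, K+1) brings
   them to the common factor. *)
have [d0 d1 d2] := bin_mul3_mod9 N K; rewrite mul_bin_diag natrM in d1 d2.
move: e0 e1 e2; rewrite (mulnS 3 K) !addSn add0n => e0 e1 e2.
pattern i, j; apply: cases;
  rewrite ?(addnS, addn0, add0n) !binS ?binS ?bin0 ?bin0n ?natrD;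
  rewrite ?d1 ?d2 ?e0 ?e1 ?e2 /=;
  set a := 'C(N, _)%:R;
  first [ by ring | by apply: (@Z9_eqDM9 (K.+1%:R * a)); ring
        | by apply: (@Z9_eqDM9 (- K.+1%:R * a)); ring
        | by apply: (@Z9_eqDM9 (N%:R * a)); ring
        | by apply: (@Z9_eqDM9 (- N%:R * a)); ring ].
Qed.

(** * Congruences modulo 3, encoded in Z/9 as [3 * x = 3 * y] *)

Lemma Z9_mul3_exp (x y : 'Z_9) e : 3 * x = 3 * y -> 3 * x ^+ e = 3 * y ^+ e.
Proof.
move=> exy; elim: e => // e IH.
by rewrite !exprS mulrCA IH mulrCA mulrA exy mulrA.
Qed.

Lemma Z9_mul3_mul (x x' y y' : 'Z_9) :
  3 * x = 3 * x' -> 3 * y = 3 * y' -> 3 * (x * y) = 3 * (x' * y').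
Proof. by move=> ex ey; rewrite mulrA ex -mulrA mulrCA ey mulrCA. Qed.

(** The first hypothesis makes [d] a multiple of 3, so its cofactor matters only modulo 3. *)
Lemma Z9_mulr_congr3 (d u v : 'Z_9) : 3 * d = 0 -> 3 * u = 3 * v -> u * d = v * d.
Proof.
move=> d0 euv; suff [c ->] : exists c, d = 3 * c.
  by rewrite mulrA (mulrC u) euv (mulrC _ v) -mulrA.
case: d d0 => n n9 /(congr1 val) d0; exists (inZp (n %/ 3)); apply: val_inj.
by move: d0; do 9?[case: n n9 => [|n] // n9].
Qed.

Lemma bfac_congr3 (j i N K : nat) : 3 * bfac j i N K = 3 * 'C(j, i)%:R.
Proof. by rewrite /bfac addrC Z9_3Ml. Qed.

(** [N] and [K] enter [bfac] only under a factor 3. *)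
Lemma bfac_mod3 (j i N K y l : nat) :
  bfac j i (3 * N + y)%N (3 * K + l)%N = bfac j i y l.
Proof.
rewrite /bfac; set a := 'C(j, i)%:R; set b := _ - 'C(j.+1, i)%:R.
set c := 'C(_, _.+2)%:R.
by apply: (@Z9_eqDM9 ((N%:R - K%:R) * b + K%:R * c)); ring.
Qed.

(** * Splitting ternary digits off Apéry numbers *)

Definition apery_term (r s n k : nat) : 'Z_9 :=
  'C(n, k)%:R ^+ r * 'C(n + k, k)%:R ^+ s.

(** The digit sum x + k, possibly 3 or 4, is not carried; it stays below k + 3, as [bin_digit_mod9]
    requires. *)
Definition term_fac (r s x k N K : nat) : 'Z_9 :=
  bfac x k N K ^+ r * bfac (x + k)%N k (N + K)%N K ^+ s.

Lemma apery_term_digit (r s N K x k : nat) : (x < 3)%N -> (k < 3)%N ->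
  apery_term r s (3 * N + x)%N (3 * K + k)%N
  = apery_term r s N K * term_fac r s x k N K.
Proof.
move=> x3 k3; rewrite /apery_term addnACA -mulnDr !bin_digit_mod9 //; try lia.
by rewrite !exprMn mulrACA.
Qed.

Lemma term_fac_congr3 (r s x k N K : nat) :
  3 * term_fac r s x k N K = 3 * apery_term r s x k.
Proof. by apply: Z9_mul3_mul; apply: Z9_mul3_exp; apply: bfac_congr3. Qed.

Lemma term_fac_mod3 (r s x k N K y l : nat) :
  term_fac r s x k (3 * N + y)%N (3 * K + l)%N = term_fac r s x k y l.
Proof. by rewrite /term_fac addnACA -mulnDr !bfac_mod3. Qed.

Definition digit_fac (r s x N K : nat) : 'Z_9 :=
  \sum_(0 <= k < 3) term_fac r s x k N K.

(** As r > 0, terms beyond n vanish, so the sum can be extended to whole blocks of three. *)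
Lemma apery_Z9 (r s n M : nat) : (0 < r)%N -> (n < M)%N ->
  (apery r s n)%:R = \sum_(0 <= k < M) apery_term r s n k :> 'Z_9.
Proof.
move=> r0 ltnM; rewrite (@big_cat_nat _ _ _ n.+1) //=.
have -> : \sum_(n.+1 <= k < M) apery_term r s n k = 0.
  rewrite big_nat; apply: big1 => k /andP[ltnk _].
  by rewrite /apery_term bin_small // expr0n gtn_eqF // mul0r.
by rewrite addr0 /apery natr_sum; apply: eq_bigr => k _; rewrite natrM !natrX.
Qed.

Lemma sum_nat3 (N : nat) (F : nat -> 'Z_9) :
  \sum_(0 <= k < 3 * N) F k
  = \sum_(0 <= K < N) \sum_(0 <= k < 3) F (3 * K + k)%N.
Proof.
rewrite mulnC big_nat_mul; apply: eq_bigr => K _.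
rewrite -{1}[(K * 3)%N]add0n big_addn mulSn addnK.
by apply: eq_bigr => k _; rewrite addnC mulnC.
Qed.

Lemma apery_digit (r s x N M : nat) : (0 < r)%N -> (x < 3)%N -> (N < M)%N ->
  (apery r s (3 * N + x)%N)%:R
  = \sum_(0 <= K < M) apery_term r s N K * digit_fac r s x N K :> 'Z_9.
Proof.
move=> r0 x3 ltNM; rewrite (@apery_Z9 r s _ (3 * M)%N) //; last lia.
rewrite sum_nat3; apply: eq_bigr => K _; rewrite mulr_sumr.
by apply: eq_big_nat => k /andP[_ k3]; rewrite apery_term_digit.
Qed.

Lemma apery_digit_sub (r s x N M : nat) : (0 < r)%N -> (x < 3)%N -> (N < M)%N ->
  (apery r s (3 * N + x)%N)%:R - (apery r s x)%:R * (apery r s N)%:R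
  = \sum_(0 <= K < M) apery_term r s N K
      * (digit_fac r s x N K - (apery r s x)%:R) :> 'Z_9.
Proof.
move=> r0 x3 ltNM; rewrite (apery_digit r s x N M) //.
rewrite (apery_Z9 r s N M) // mulr_sumr -sumrB.
by apply: eq_bigr => K _; ring.
Qed.

Lemma digit_fac_congr3 (r s x N K : nat) : (0 < r)%N -> (x < 3)%N ->
  3 * (digit_fac r s x N K - (apery r s x)%:R) = 0.
Proof.
move=> r0 x3; rewrite (apery_Z9 r s x 3) // mulrBr !mulr_sumr -sumrB.
rewrite big1 // => k _.
by rewrite term_fac_congr3 subrr.
Qed.

Lemma apery_mod3_digit (r s x N : nat) : (0 < r)%N -> (x < 3)%N ->
  3 * (apery r s (3 * N + x)%N)%:R
  = 3 * ((apery r s x)%:R * (apery r s N)%:R) :> 'Z_9.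
Proof.
move=> r0 x3; apply/eqP; rewrite -subr_eq0 -mulrBr.
rewrite (apery_digit_sub r s x N N.+1) //.
by rewrite mulr_sumr big1 // => K _; rewrite mulrCA digit_fac_congr3 // mulr0.
Qed.

(** In [apery_digit_sub] the bracket depends only on the lowest digits of its indices and is a
    multiple of 3. Splitting the outer sum into blocks of three therefore requires the new factor
    [term_fac] only modulo 3, where it is a term of a_y. *)
Lemma apery_two_digits (r s x y N : nat) : (0 < r)%N -> (x < 3)%N -> (y < 3)%N ->
  (apery r s (3 * (3 * N + y) + x)%N)%:R
    - (apery r s x)%:R * (apery r s (3 * N + y)%N)%:R
  = (apery r s N)%:R
    * ((apery r s (3 * y + x)%N)%:R - (apery r s x)%:R * (apery r s y)%:R)
  :> 'Z_9.
Proof.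
move=> r0 x3 y3; rewrite (apery_digit_sub r s x _ (3 * N.+1)%N) //; last lia.
rewrite (apery_digit_sub r s x y 3) // sum_nat3.
rewrite (apery_Z9 r s N N.+1) // mulr_suml.
apply: eq_bigr => K _; rewrite mulr_sumr; apply: eq_big_nat => l /andP[_ l3].
rewrite apery_term_digit // -mulrA; congr (_ * _).
rewrite {1}/digit_fac; under eq_bigr do rewrite term_fac_mod3.
by apply: Z9_mulr_congr3; [apply: digit_fac_congr3 | apply: term_fac_congr3].
Qed.

(** * Two-digit numbers: finite check and periodicity *)

(* Every intermediate value is reduced modulo 9 so that computing with unary
   numbers stays cheap. *)
Definition expm9 (x e : nat) : nat := iter e (fun y => x * y %% 9)%N 1%N.

Definition apery_mod9 (r s n : nat) : nat :=
  foldr (fun k a => (expm9 ('C(n, k) %% 9) r * expm9 ('C(n + k, k) %% 9) s + a)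
                    %% 9)%N 0%N (iota 0 n.+1).

Definition pair_check (r s x y : nat) : bool :=
  (apery_mod9 r s (3 * y + x)
     == (apery_mod9 r s x)%:Z * (apery_mod9 r s y)%:Z + 3 * apery_f x%:Z y%:Z r s
   %[mod 9])%Z.

(** Exponent 1 is separate because of [chi]; 2 to 7 form a full period. *)
Lemma pair_check_small :
  all (fun r => all (fun s => all (fun x => all (pair_check r s x) (iota 0 3))
    (iota 0 3)) (iota 1 7)) (iota 1 7).
Proof. by vm_compute. Qed.

Lemma expm9E (x e : nat) : (expm9 x e)%:R = x%:R ^+ e :> 'Z_9.
Proof. by elim: e => //= e IH; rewrite Zp_nat_mod // natrM IH exprS. Qed.

Lemma apery_mod9E (r s n : nat) :
  (apery_mod9 r s n)%:R = (apery r s n)%:R :> 'Z_9.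
Proof.
rewrite /apery /apery_mod9 /index_iota subn0; elim: iota => [|k l IH] /=.
  by rewrite big_nil.
rewrite big_cons Zp_nat_mod // !natrD IH !natrM !expm9E !natrX.
by rewrite !(@Zp_nat_mod 9).
Qed.

Lemma modz9_intr (x y : int) : (x = y %[mod 9])%Z -> x%:~R = y%:~R :> 'Z_9.
Proof.
move/eqP; rewrite eqz_mod_dvd => /dvdzP[q e]; apply/eqP.
rewrite -subr_eq0 -rmorphB /= e rmorphM /=.
by rewrite (_ : 9%:~R = 0) ?mulr0 //; apply: val_inj.
Qed.

Lemma modz9_pair (a b c : nat) (z : int) :
  (a = b%:Z * c%:Z + 3 * z %[mod 9])%Z ->
  a%:R = b%:R * c%:R + 3 * z%:~R :> 'Z_9.
Proof. by move/modz9_intr; rewrite rmorphD !rmorphM. Qed.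

(** Units of Z/9 have order dividing 6, and multiples of 3 have square 0. *)
Lemma Z9_expD6 (x : 'Z_9) e : (1 < e)%N -> x ^+ (e + 6) = x ^+ e.
Proof.
have x8 : x ^+ 8 = x ^+ 2.
  by case: x => n n9; apply: val_inj; do 9?[case: n n9 => [|n] // n9].
case: e => [|[|e]] // _; rewrite (_ : (e.+2 + 6 = 8 + e)%N); last lia.
by rewrite exprD x8 -exprD.
Qed.

Definition pair_congr (r s x y : nat) : Prop :=
  (apery r s (3 * y + x)%N)%:R
  = (apery r s x)%:R * (apery r s y)%:R + 3 * (apery_f x%:Z y%:Z r s)%:~R :> 'Z_9.

Lemma apery_r_period (r s n : nat) : (1 < r)%N ->
  (apery (r + 6)%N s n)%:R = (apery r s n)%:R :> 'Z_9.
Proof.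
move=> r1; rewrite !natr_sum; apply: eq_bigr => k _.
by rewrite !natrM !natrX Z9_expD6.
Qed.

Lemma apery_s_period (r s n : nat) : (1 < s)%N ->
  (apery r (s + 6)%N n)%:R = (apery r s n)%:R :> 'Z_9.
Proof.
move=> s1; rewrite !natr_sum; apply: eq_bigr => k _.
by rewrite !natrM !natrX Z9_expD6.
Qed.

Lemma signrD6 e : (-1) ^+ (e + 6) = (-1) ^+ e :> int.
Proof. by rewrite exprD mulr1. Qed.

(** Above exponent 1 the [chi] terms are constant, signs have period 2 and the rest is linear in [r]
    and [s], so a shift by 6 changes f by a multiple of 3. *)
Lemma apery_f_period (r s : nat) (x y : int) :
  ((1 < r)%N ->
    3 * (apery_f x y (r + 6)%N s)%:~R = 3 * (apery_f x y r s)%:~R :> 'Z_9) /\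
  ((1 < s)%N ->
    3 * (apery_f x y r (s + 6)%N)%:~R = 3 * (apery_f x y r s)%:~R :> 'Z_9).
Proof.
have dvd3 (u v z : int) : u = 3 * z + v -> 3 * u%:~R = 3 * v%:~R :> 'Z_9.
  by move=> ->; rewrite rmorphD rmorphM /= Z9_3Ml.
split=> gt1.
- apply: (dvd3 _ _ (x * (x + 1) * y * (-1) ^+ s * (2 * y))).
  rewrite /apery_f signrD6 PoszD (_ : (r + 6 == 1)%N = (r == 1)%N); last lia.
  by ring.
apply: (dvd3 _ _ (x * (x + 1) * y * (2 * (y + 1) + (-1) ^+ s * (2 * (y - 1))))).
rewrite /apery_f signrD6 PoszD (_ : (s + 6 == 1)%N = (s == 1)%N); last lia.
by ring.
Qed.

Lemma period6_ind (P : nat -> Prop) :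
  (forall e, (0 < e < 8)%N -> P e) ->
  (forall e, (1 < e)%N -> P e -> P (e + 6)%N) ->
  forall e, (0 < e)%N -> P e.
Proof.
move=> Psmall Pstep e; elim/ltn_ind: e => e IH e0.
have [e8 | e8] := ltnP e 8; first by apply: Psmall; rewrite e0.
(* Here e - 6 >= 2, so [Pstep] applies. *)
by rewrite -(@subnK 6 e); [apply: Pstep; [|apply: IH]; lia | lia].
Qed.

Lemma pair_congrP (r s x y : nat) : (0 < r)%N -> (0 < s)%N ->
  (x < 3)%N -> (y < 3)%N -> pair_congr r s x y.
Proof.
move=> r0 s0 x3 y3.
move: r r0; apply: period6_ind => [r r8 | r r1 IH]; last first.
  have [fr _] := apery_f_period r s x%:Z y%:Z.
  by rewrite /pair_congr !apery_r_period // fr.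
move: s s0; apply: period6_ind => [s s8 | s s1 IH]; last first.
  have [_ fs] := apery_f_period r s x%:Z y%:Z.
  by rewrite /pair_congr !apery_s_period // fs.
move/allP: pair_check_small => /(_ r); rewrite mem_iota => /(_ r8).
move/allP => /(_ s); rewrite mem_iota => /(_ s8).
move/allP => /(_ x); rewrite mem_iota => /(_ x3).
move/allP => /(_ y); rewrite mem_iota => /(_ y3).
by move/eqP/modz9_pair; rewrite /pair_congr -!apery_mod9E.
Qed.

(** * From two digits to all digits *)

(** Induction on [m], peeling off the lowest digit. In the correction term the remaining value of
    [A] is multiplied by [t], hence may be replaced by the product over its digits. *)
Lemma digit_expansion (R : comNzRingType) (A : nat -> R)
    (F : nat -> nat -> R) (t : R) :
  A 0%N = 1 ->
  (forall x N, (x < 3)%N -> t * A (3 * N + x)%N = t * (A x * A N)) ->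
  (forall x y N, (x < 3)%N -> (y < 3)%N ->
     A (3 * (3 * N + y) + x)%N = A x * A (3 * N + y)%N + t * (A N * F x y)) ->
  forall m (d : nat -> nat), (forall i, (i <= m)%N -> (d i <= 2)%N) ->
  A (\sum_(0 <= i < m.+1) 3 ^ i * d i)%N =
    \prod_(0 <= i < m.+1) A (d i)
    + t * \sum_(1 <= nu < m.+1)
        (\prod_(0 <= i < m.+1 | (i != nu.-1) && (i != nu)) A (d i))
        * F (d nu.-1) (d nu).
Proof.
move=> A0 At AF.
have sumS m (d : nat -> nat) : (\sum_(0 <= i < m.+1) 3 ^ i * d i
    = 3 * (\sum_(0 <= i < m) 3 ^ i * d i.+1) + d 0)%N.
  rewrite big_nat_recl // mul1n addnC big_distrr /=; congr addn.
  by apply: eq_bigr => i _; rewrite expnS mulnA.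
have tprod m (d : nat -> nat) : (forall i, (i < m)%N -> (d i <= 2)%N) ->
    t * A (\sum_(0 <= i < m) 3 ^ i * d i)%N = t * \prod_(0 <= i < m) A (d i).
  elim: m d => [|m IH] d d2; first by rewrite !big_geq // A0.
  have d0 : (d 0%N < 3)%N by apply: d2.
  rewrite sumS (At _ _ d0) mulrCA IH.
    by rewrite mulrCA [in RHS]big_nat_recl.
  by move=> i im; apply: d2.
elim=> [|m IH] d d2.
  by rewrite !big_nat1 expn0 mul1n !big_geq // mulr0 addr0.
have d0 : (d 0%N < 3)%N by apply: d2.
have d1 : (d 1%N < 3)%N by apply: d2.
rewrite sumS (sumS m) (AF _ _ _ d0 d1) -(sumS m (fun i => d i.+1)).
rewrite IH; last by move=> i im; apply: d2.
rewrite [X in _ = X + _](@big_nat_recl _ _ _ _ 0) //.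
rewrite mulrDr -addrA; congr (_ + _).
rewrite [in RHS](@big_nat_recl _ _ _ _ 1) //=.
rewrite [in RHS]mulrDr addrC; congr (_ + _).
  (* The new correction is the term nu = 1; those of the induction hypothesis, shifted by one and
     multiplied by A (d 0), are the terms nu >= 2. *)
  rewrite mulrA (tprod m (fun i => d i.+2)); last by move=> i im; apply: d2.
  by rewrite -mulrA [in RHS]big_mkcond !big_nat_recl //= !mul1r.
rewrite mulrCA mulr_sumr; congr (_ * _).
rewrite [LHS]big_nat [RHS]big_nat; apply: eq_bigr => -[|nu] // _.
rewrite mulrA; congr (_ * _).
by rewrite big_mkcond [in RHS]big_mkcond [in RHS]big_nat_recl.
Qed.

Theorem theorem2 (r s : nat) (r_gt0 : (0 < r)%N) (s_gt0 : (0 < s)%N)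
    (n m : nat) (d : nat -> nat)
    (d_le2 : forall i : nat, (i <= m)%N -> (d i <= 2)%N)
    (n_digits : n = (\sum_(0 <= i < m.+1) 3 ^ i * d i)%N) :
  ((apery r s n)%:Z =
     \prod_(0 <= i < m.+1) (apery r s (d i))%:Z
     + 3 * \sum_(1 <= nu < m.+1)
             (\prod_(0 <= i < m.+1 | (i != nu.-1) && (i != nu))
                (apery r s (d i))%:Z)
             * apery_f (d nu.-1)%:Z (d nu)%:Z r s
   %[mod 9])%Z.
Proof.
rewrite n_digits; apply: intr9_mod; rewrite rmorphD rmorph_prod rmorphM.
rewrite [X in _ = _ + _ * X]rmorph_sum.
under [X in _ = _ + _ * X]eq_bigr do rewrite rmorphM rmorph_prod.
apply: (digit_expansion 'Z_9 (fun n => (apery r s n)%:R)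
          (fun x y => (apery_f x%:Z y%:Z r s)%:~R)) d_le2.
- by rewrite /apery big_nat1 !bin0 !exp1n.
- by move=> x N x3; apply: apery_mod3_digit.
move=> x y N x3 y3; have := apery_two_digits r s x y N r_gt0 x3 y3.
rewrite (pair_congrP r s x y) // => /(canRL (subrK _)) ->; ring.
Qed.
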